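(* Let $G$ be a finite, connected, simple graph. Every minimal splitting of the toric ideal $I_G$ is also a reduced splitting of $I_G$.
   Context: Let $K$ be any field. Let $G$ be a finite, connected, undirected graph without loops or multiple edges, with vertices $v_1,\dots,v_n$ and edge set $E(G)=\{e_1,\dots,e_m\}$. The edges are also used as variables of the polynomial ring $K[e_1,\dots,e_m]$, and the toric ideal $I_G\subset K[e_1,\dots,e_m]$ is the kernel of the $K$-algebra map $K[e_1,\dots,e_m]\to K[v_1,\dots,v_n]$ sending an edge $e=\{v_i,v_j\}$ to $v_iv_j$. For a subgraph $H$ of $G$ (not necessarily connected), $I_H$ is defined in the same way in the variables $E(H)$ and is regarded as the ideal it generates in $K[e_1,\dots,e_m]$. A subgraph splitting of $I_G$ is an equality $I_G=I_{G_1}+I_{G_2}$ with $G_1,G_2$ subgraphs of $G$, $I_{G_1}\neq I_G$ and $I_{G_2}\neq I_G$. A minimal system of binomial generators of such an ideal is an inclusion-minimal generating set consisting of binomials (differences of two monomials). Let $I_G=I_{G_1}+I_{G_2}$ be a subgraph splitting, let $\{f_1,\dots,f_r\}$ be a minimal system of binomial generators of $I_{G_1}$ and $\{g_1,\dots,g_t\}$ a minimal system of binomial generators of $I_{G_2}$ (with $r$, $t$ elements respectively). The splitting is a minimal splitting of $I_G$ if $f_1,\dots,f_r,g_1,\dots,g_t$ are $r+t$ distinct elements forming a minimal system of generators of $I_G$; this property does not depend on the chosen minimal systems of generators of $I_{G_1}$ and $I_{G_2}$. The subgraph splitting $I_G=I_{G_1}+I_{G_2}$ is a reduced splitting if for any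 subgraphs $H_1$ of $G_1$ and $H_2$ of $G_2$ with $I_G=I_{H_1}+I_{H_2}$ it holds that $I_{H_1}=I_{G_1}$ and $I_{H_2}=I_{G_2}$. *)

(* Defs.v *)
From HB Require Import structures.
From mathcomp Require Import all_boot all_order all_algebra.
From mathcomp Require Import mpoly.

Set Implicit Arguments.
Unset Strict Implicit.
Unset Printing Implicit Defensive.

Import GRing.Theory.
Local Open Scope ring_scope.

(* Ideals are Prop-valued predicates, compared extensionally. *)
Section Ideals.
Variable R : comNzRingType.
Implicit Types (I J S : R -> Prop) (s : seq R).

Definition eq_ideal I J : Prop := forall p, I p <-> J p.

Definition ideal_gen S : R -> Prop := fun p =>
  exists (k : nat) (a f : 'I_k -> R),
    (forall i, S (f i)) /\ p = \sum_(i < k) a i * f i.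

Definition ideal_add I J : R -> Prop := fun p =>
  exists a b, [/\ I a, J b & p = a + b].

Definition generates s I : Prop :=
  eq_ideal (ideal_gen (fun p => p \in s)) I.

(* A finite set of generators is a duplicate-free sequence, so that [size s]
   is its number of elements; minimality is with respect to inclusion. *)
Definition min_gens s I : Prop :=
  [/\ uniq s,
      generates s I
    & forall s', {subset s' <= s} -> generates s' I -> {subset s <= s'}].

End Ideals.

(* A simple graph on the vertices 'I_n with edges labelled by 'I_m:
   [edge_card] excludes loops and [edge_inj] excludes multiple edges. *)
Record sgraph (n m : nat) := SGraph {
  edge : 'I_m -> {set 'I_n};
  edge_card : forall i, #|edge i| = 2;
  edge_inj : injective edge
}.

Definition adj n m (G : sgraph n m) : rel 'I_n :=
  fun u v => [exists i, edge G i == [set u; v]].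

Definition connected_graph n m (G : sgraph n m) : Prop :=
  forall u v, connect (adj G) u v.

Record subgraph n m (G : sgraph n m) := Subgraph {
  sub_verts : {set 'I_n};
  sub_edges : {set 'I_m};
  sub_incident : forall i, i \in sub_edges -> edge G i \subset sub_verts
}.

Definition subgraph_le n m (G : sgraph n m) (H1 H2 : subgraph G) : Prop :=
  sub_verts H1 \subset sub_verts H2 /\ sub_edges H1 \subset sub_edges H2.

Section Toric.
Variables (K : fieldType) (n m : nat) (G : sgraph n m).
Implicit Types (p : {mpoly K[m]}) (H : subgraph G).

Definition edge_monomial (i : 'I_m) : {mpoly K[n]} :=
  \prod_(v in edge G i) 'X_v.

Definition edge_map p : {mpoly K[n]} :=
  p \mPo [tuple edge_monomial i | i < m].

Definition toric_ideal : {mpoly K[m]} -> Prop := fun p => edge_map p = 0.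

(* K[E(H)], as a subring of K[e_1, ..., e_m]. *)
Definition in_edge_ring H p : Prop :=
  forall u, u \in msupp p -> forall i, u i != 0%N -> i \in sub_edges H.

(* The kernel of K[E(H)] -> K[V(H)] (the restriction of [edge_map]), extended
   to K[e_1, ..., e_m]. *)
Definition sub_toric_ideal H : {mpoly K[m]} -> Prop :=
  ideal_gen (fun p => in_edge_ring H p /\ edge_map p = 0).

Definition is_binomial p : Prop :=
  exists u v : 'X_{1..m}, p = 'X_[u] - 'X_[v].

Definition min_binomial_gens (s : seq {mpoly K[m]}) I : Prop :=
  min_gens s I /\ (forall p, p \in s -> is_binomial p).

Definition splits (G1 G2 : subgraph G) : Prop :=
  eq_ideal toric_ideal (ideal_add (sub_toric_ideal G1) (sub_toric_ideal G2)).

Definition subgraph_splitting (G1 G2 : subgraph G) : Prop :=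
  [/\ splits G1 G2,
      ~ eq_ideal (sub_toric_ideal G1) toric_ideal
    & ~ eq_ideal (sub_toric_ideal G2) toric_ideal].

(* The property does not depend on the chosen systems [f] and [g]; the
   existential form gives the weaker hypothesis when it is assumed. *)
Definition minimal_splitting (G1 G2 : subgraph G) : Prop :=
  subgraph_splitting G1 G2 /\
  exists f g : seq {mpoly K[m]},
    [/\ min_binomial_gens f (sub_toric_ideal G1),
        min_binomial_gens g (sub_toric_ideal G2)
      & min_gens (f ++ g) toric_ideal].

Definition reduced_splitting (G1 G2 : subgraph G) : Prop :=
  subgraph_splitting G1 G2 /\
  forall H1 H2 : subgraph G,
    subgraph_le H1 G1 -> subgraph_le H2 G2 -> splits H1 H2 ->
    eq_ideal (sub_toric_ideal H1) (sub_toric_ideal G1) /\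
    eq_ideal (sub_toric_ideal H2) (sub_toric_ideal G2).

End Toric.

Arguments edge_map K {n m} G p.
Arguments toric_ideal K {n m} G p.
Arguments sub_toric_ideal K {n m G} H p.
Arguments splits K {n m G} G1 G2.
Arguments subgraph_splitting K {n m G} G1 G2.
Arguments minimal_splitting K {n m G} G1 G2.
Arguments reduced_splitting K {n m G} G1 G2.

(* Main.v *)
Require Import Defs.
From mathcomp Require Import all_boot all_order all_algebra.
From mathcomp Require Import mpoly.

Set Implicit Arguments.
Unset Strict Implicit.
Unset Printing Implicit Defensive.

Import GRing.Theory.
Local Open Scope ring_scope.

(** The argument is a graded Nakayama lemma. The edge map doubles degrees, so
    toric ideals of subgraphs are homogeneous ([ideal_gen_pihomog],
    [sub_toric_gens_pihomog]) and every binomial lying in one is homogeneous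
    ([toric_binomial_homog]). Write m for the ideal of K[e_1, ..., e_m]
    generated by the variables. In a relation between inclusion-minimal
    homogeneous generators no coefficient has a constant term
    ([min_gens_relation]). Applied to the minimal system f_1, ..., f_r,
    g_1, ..., g_t of I_G, this says that the intersection of I_{G_1} and
    I_{G_2} is contained in m I_{G_1}.

    Now let I_G = I_{H_1} + I_{H_2} with H_1, H_2 subgraphs of G_1, G_2. An
    element p of I_{G_1} is a + b with a in I_{H_1} and b in I_{H_2}, and
    b = p - a lies in both I_{G_1} and I_{G_2}, hence in m I_{G_1}. Thus
    I_{G_1} = I_{H_1} + m I_{G_1}, and Nakayama's lemma gives
    I_{G_1} = I_{H_1}. [min_gens_cat_reduced] carries this out for arbitrary
    homogeneous ideals, with Nakayama's lemma unfolded into an induction on the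
    degree of the generators f_i; the roles of f and g are then exchanged. *)

(** * Ideals generated by a set *)

Lemma ideal_gen0 (R : comNzRingType) (S : R -> Prop) : ideal_gen S 0.
Proof.
by exists 0%N, (fun=> 0), (fun=> 0); split; [case | rewrite big_ord0].
Qed.

Lemma ideal_genMS (R : comNzRingType) (S : R -> Prop) (a f : R) :
  S f -> ideal_gen S (a * f).
Proof.
by move=> Sf; exists 1%N, (fun=> a), (fun=> f); split; rewrite ?big_ord1.
Qed.

Lemma mem_ideal_gen (R : comNzRingType) (S : R -> Prop) (f : R) :
  S f -> ideal_gen S f.
Proof. by rewrite -{2}[f]mul1r; apply: ideal_genMS. Qed.

Lemma ideal_genD (R : comNzRingType) (S : R -> Prop) (p q : R) :
  ideal_gen S p -> ideal_gen S q -> ideal_gen S (p + q).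
Proof.
case=> [k [a [f [Sf ->]]]] [l [b [g [Sg ->]]]].
pose glue (u : 'I_k -> R) (v : 'I_l -> R) (i : 'I_(k + l)) :=
  match split i with inl j => u j | inr j => v j end.
exists (k + l)%N, (glue a b), (glue f g); split.
  by move=> i; rewrite /glue; case: (split i).
rewrite big_split_ord /glue; congr (_ + _); apply: eq_bigr => i _.
  by rewrite (unsplitK (inl i)).
by rewrite (unsplitK (inr i)).
Qed.

Lemma ideal_genM (R : comNzRingType) (S : R -> Prop) (c p : R) :
  ideal_gen S p -> ideal_gen S (c * p).
Proof.
case=> [k [a [f [Sf ->]]]]; exists k, (fun i => c * a i), f; split=> //.
by rewrite mulr_sumr; apply: eq_bigr => i _; rewrite mulrA.
Qed.

Lemma ideal_genB (R : comNzRingType) (S : R -> Prop) (p q : R) :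
  ideal_gen S p -> ideal_gen S q -> ideal_gen S (p - q).
Proof.
by move=> Sp Sq; apply: ideal_genD => //; rewrite -mulN1r; apply: ideal_genM.
Qed.

Lemma ideal_gen_sum (R : comNzRingType) (S : R -> Prop) (I : eqType)
    (r : seq I) (F : I -> R) :
  (forall i, i \in r -> ideal_gen S (F i)) ->
  ideal_gen S (\sum_(i <- r) F i).
Proof.
elim: r => [|i r IHr] SF; first by rewrite big_nil; apply: ideal_gen0.
rewrite big_cons; apply: ideal_genD; first by apply: SF; rewrite inE eqxx.
by apply: IHr => j rj; apply: SF; rewrite inE rj orbT.
Qed.

Lemma ideal_gen_idem (R : comNzRingType) (S T : R -> Prop) (p : R) :
  (forall q, S q -> ideal_gen T q) -> ideal_gen S p -> ideal_gen T p.
Proof.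
move=> ST [k [a [f [Sf ->]]]].
by apply: ideal_gen_sum => i _; apply/ideal_genM/ST/Sf.
Qed.

Lemma ideal_gen_mono (R : comNzRingType) (S T : R -> Prop) (p : R) :
  (forall q, S q -> T q) -> ideal_gen S p -> ideal_gen T p.
Proof.
by move=> ST; apply: ideal_gen_idem => q /ST; apply: mem_ideal_gen.
Qed.

(** Grouping the terms of a combination by the value of the generator yields
    coefficients indexed by the generators themselves; coefficients for two
    disjoint systems then glue to a single function. *)
Lemma ideal_gen_uniq_seq (R : comNzRingType) (s : seq R) (p : R) : uniq s ->
  ideal_gen (fun q => q \in s) p ->
  exists c : R -> R, p = \sum_(x <- s) c x * x.
Proof.
move=> s_uniq [k [a [f [sf ->]]]].
exists (fun x => \sum_(i < k | f i == x) a i).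
under [RHS]eq_bigr => x _ do rewrite mulr_suml big_mkcond.
rewrite exchange_big /=; apply: eq_bigr => i _.
rewrite (bigD1_seq (f i)) //= eqxx big1 ?addr0 // => x.
by rewrite eq_sym => /negbTE->.
Qed.

Lemma ideal_addC (R : comNzRingType) (I J : R -> Prop) (p : R) :
  ideal_add I J p -> ideal_add J I p.
Proof. by case=> a [b [Ia Jb ->]]; exists b, a; split=> //; rewrite addrC. Qed.

(** * Homogeneous components *)

Lemma mcoeff_pihomog (R : nzRingType) (n d : nat) (p : {mpoly R[n]})
    (u : 'X_{1..n}) :
  (pihomog mdeg d p)@_u = if mdeg u == d then p@_u else 0.
Proof.
have -> : (if mdeg u == d then p@_u else 0) =
    \sum_(v <- msupp p) (if mdeg u == d then (p@_v *: 'X_[v])@_u else 0).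
  by case: ifP => _; [rewrite {1}(mpolyE p) raddf_sum | rewrite big1].
rewrite pihomogE raddf_sum big_mkcond /=; apply: eq_bigr => v _.
rewrite [in RHS]mcoeffZ mcoeffX; case: (v =P u) => [->|/eqP/negbTE vu].
  by case: ifP; rewrite ?mcoeff0 // mcoeffZ mcoeffX eqxx.
rewrite mulr0 if_same; case: ifP; rewrite ?mcoeff0 //.
by rewrite mcoeffZ mcoeffX vu mulr0.
Qed.

Lemma pihomogM_dhomog (R : comNzRingType) (n d e : nat)
    (a f : {mpoly R[n]}) :
  f \is e.-homog ->
  pihomog mdeg d (a * f) =
    (if (e <= d)%N then pihomog mdeg (d - e) a else 0) * f.
Proof.
move=> f_homog.
have -> : (if (e <= d)%N then pihomog mdeg (d - e) a else 0) =
    \sum_(u <- msupp a) a@_u *: (if (mdeg u + e)%N == d then 'X_[u] else 0).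
  case: leqP => led; last first.
    rewrite big1 // => u _; rewrite ifN ?scaler0 // neq_ltn.
    by rewrite (leq_trans led (leq_addl _ _)) orbT.
  rewrite {1}(mpolyE a) raddf_sum /=; apply: eq_bigr => u _.
  by rewrite linearZ /= pihomogX -[in RHS](subnK led) eqn_add2r.
rewrite {1}(mpolyE a) !mulr_suml raddf_sum /=; apply: eq_bigr => u _.
rewrite -!scalerAl linearZ /=; congr (_ *: _).
have Xf : 'X_[u] * f \is (mdeg u + e).-homog.
  by apply: dhomogM => //; rewrite dhomogX.
case: eqP Xf => [->|/eqP ne] Xf; first exact: pihomog_dE.
by rewrite mul0r (pihomog_ne0 ne Xf).
Qed.

(** The generators in [S] need not be homogeneous: each is the sum of its
    components, which belong to [S] as well, so the ideal is generated by
    homogeneous elements. *)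
Lemma ideal_gen_pihomog (R : comNzRingType) (n : nat)
    (S : {mpoly R[n]} -> Prop) (d : nat) (p : {mpoly R[n]}) :
  (forall e q, S q -> S (pihomog mdeg e q)) ->
  ideal_gen S p -> ideal_gen S (pihomog mdeg d p).
Proof.
move=> S_homog [k [a [f [Sf ->]]]]; rewrite raddf_sum /=.
apply: ideal_gen_sum => i _.
rewrite (pihomog_partitionE (leqnn (msize (f i)))) mulr_sumr raddf_sum /=.
apply: ideal_gen_sum => e _; rewrite (pihomogM_dhomog _ _ (pihomogP mdeg e _)).
exact/ideal_genMS/S_homog.
Qed.

Lemma pihomog_deg0 (R : nzRingType) (n : nat) (p : {mpoly R[n]}) :
  pihomog mdeg 0 p = (p@_0)%:MP.
Proof.
apply/mpolyP => u; rewrite mcoeff_pihomog mcoeffC mdeg_eq0.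
by case: eqP => [->|]; rewrite ?mulr1 ?mulr0.
Qed.

(** * Minimal systems of homogeneous generators *)

Lemma generates_subset (R : comNzRingType) (s t : seq R) (I : R -> Prop) :
  {subset t <= s} ->
  (forall x, x \in s -> ideal_gen (fun p => p \in t) x) ->
  generates s I -> generates t I.
Proof.
move=> ts st s_gen p; rewrite -(s_gen p); split.
  by apply: ideal_gen_mono.
exact: ideal_gen_idem.
Qed.

Lemma min_gens_perm (R : comNzRingType) (s t : seq R) (I : R -> Prop) :
  perm_eq s t -> min_gens s I -> min_gens t I.
Proof.
move=> st [s_uniq s_gen s_min]; have st_mem := perm_mem st.
split; first by rewrite -(perm_uniq st).
  apply: generates_subset s_gen => x; rewrite st_mem // => tx.
  exact: mem_ideal_gen.
move=> t' t't t'_gen x; rewrite -st_mem; apply: s_min t'_gen x.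
by move=> y /t't; rewrite st_mem.
Qed.

(** If the coefficient of [x0] had a nonzero constant term, the component of the
    relation in the degree of [x0] would have this scalar as the coefficient of
    [x0], and [x0] would be a combination of the other generators. *)
Lemma min_gens_relation (K : fieldType) (n : nat) (s : seq {mpoly K[n]})
    (I : {mpoly K[n]} -> Prop) (c : {mpoly K[n]} -> {mpoly K[n]}) :
  min_gens s I -> (forall x, x \in s -> x \is homog mdeg) ->
  \sum_(x <- s) c x * x = 0 -> forall x, x \in s -> (c x)@_0 = 0.
Proof.
case=> s_uniq s_gen s_min s_homog rel x0 s_x0; apply/eqP/negPn/negP => c0.
pose deg (x : {mpoly K[n]}) := (msize x).-1.
pose b x := if (deg x <= deg x0)%N then pihomog mdeg (deg x0 - deg x) (c x)
            else 0.
have relb : \sum_(x <- s) b x * x = 0.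
  apply: etrans (pihomog0 _ mdeg (deg x0)); rewrite -[in RHS]rel raddf_sum /=.
  rewrite big_seq [RHS]big_seq; apply: eq_bigr => x /s_homog x_homog.
  by rewrite (pihomogM_dhomog _ _ x_homog).
pose s' := rem x0 s.
have s'_x0 : x0 \notin s' by rewrite mem_rem_uniq // !inE eqxx.
have s's : {subset s' <= s} by move=> x; apply: mem_rem.
suff /(s_min _ s's)/(_ _ s_x0) : generates s' I by apply/negP.
apply: generates_subset s_gen => // x s_x.
have [->|x_x0] := eqVneq x x0; last first.
  by apply: mem_ideal_gen; rewrite mem_rem_uniq // !inE x_x0.
move: relb; rewrite (big_rem x0) //= {1}/b leqnn subnn pihomog_deg0.
rewrite mul_mpolyC => /eqP; rewrite addr_eq0 => /eqP x0E.
rewrite -[x0]scale1r -(mulVf c0) -scalerA x0E -mul_mpolyC -mulN1r.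
do 2!apply: ideal_genM; apply: ideal_gen_sum => y s'_y.
exact: ideal_genMS.
Qed.

(** Graded Nakayama argument for [I1 = J + m I1], where [J] is the homogeneous
    ideal generated by [S]. Let [x] in [f] have degree [d] and write [x = a + b]
    as in the last hypothesis. Expanding [a] over [f] and [b] over [g] gives a
    relation between minimal generators, so the expansion of [a] involves [x]
    with constant term 1 and every other element of [f] with constant term 0.
    The component of [a] of degree [d], which is in [J], is therefore [x] plus a
    combination of elements of [f] of smaller degree. *)
Lemma min_gens_cat_reduced (K : fieldType) (n : nat) (f g : seq {mpoly K[n]})
    (I I1 I2 S : {mpoly K[n]} -> Prop) :
  min_gens (f ++ g) I -> (forall x, x \in f ++ g -> x \is homog mdeg) ->
  generates f I1 -> generates g I2 ->
  (forall d p, S p -> S (pihomog mdeg d p)) ->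
  (forall p, ideal_gen S p -> I1 p) ->
  (forall p, I1 p -> ideal_add (ideal_gen S) I2 p) ->
  forall p, I1 p -> ideal_gen S p.
Proof.
move=> fg_min fg_homog f_gen g_gen S_homog S_I1 I1_add.
pose deg (x : {mpoly K[n]}) := (msize x).-1.
suff f_S d x : x \in f -> deg x = d -> ideal_gen S x.
  move=> p /f_gen; apply: ideal_gen_idem => x fx.
  exact: f_S fx erefl.
elim/ltn_ind: d x => d IHd x fx deg_x.
have [fg_uniq _ _] := fg_min.
move: (fg_uniq); rewrite cat_uniq => /and3P[f_uniq /hasPn fg_disj g_uniq].
have /I1_add[a [b [Sa I2b xE]]] : I1 x.
  exact/f_gen/mem_ideal_gen.
have /f_gen/(ideal_gen_uniq_seq f_uniq)[al aE] := S_I1 _ Sa.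
have /g_gen/(ideal_gen_uniq_seq g_uniq)[be bE] := I2b.
(* the relation x - a - b = 0, expanded over f ++ g *)
pose c y := if y \in f then (y == x)%:R - al y else - be y.
have rel : \sum_(y <- f ++ g) c y * y = 0.
  rewrite big_cat /=.
  have -> : \sum_(y <- g) c y * y = - b.
    rewrite bE -sumrN big_seq [RHS]big_seq; apply: eq_bigr => y gy.
    by rewrite /c (negbTE (fg_disj _ gy)) mulNr.
  have -> : \sum_(y <- f) c y * y = x - a.
    rewrite aE big_seq.
    under eq_bigr => y fy do rewrite /c fy mulrBl.
    rewrite -big_seq big_split sumrN /=; congr (_ - _).
    rewrite (bigD1_seq x) //= eqxx mul1r big1 ?addr0 // => y /negbTE->.
    by rewrite mul0r.
  by rewrite xE -addrA -opprD subrr.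
have al0 y : y \in f -> (al y)@_0 = (y == x)%:R.
  move=> fy; apply/esym/eqP; rewrite -subr_eq0.
  have := min_gens_relation fg_min fg_homog rel (x := y).
  rewrite mem_cat fy /c fy => /(_ isT) <-.
  by rewrite mcoeffB; case: (y == x); rewrite ?mcoeff0 ?mcoeff1 ?eqxx.
have: ideal_gen S (pihomog mdeg d a) by apply: ideal_gen_pihomog.
pose t y := if (deg y <= d)%N then pihomog mdeg (d - deg y) (al y) else 0.
have -> : pihomog mdeg d a = \sum_(y <- f) t y * y.
  rewrite aE raddf_sum /= big_seq [RHS]big_seq; apply: eq_bigr => y fy.
  have y_homog : y \is homog mdeg by apply: fg_homog; rewrite mem_cat fy.
  by rewrite (pihomogM_dhomog _ _ y_homog).
rewrite (big_rem x) //= {1}/t deg_x leqnn subnn pihomog_deg0 al0 // eqxx mul1r.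
set r := \sum_(y <- _) _ => Sxr; rewrite -[x](addrK r); apply: ideal_genB => //.
apply: ideal_gen_sum => y; rewrite mem_rem_uniq // !inE => /andP[yx fy].
rewrite /t; case: ltngtP => [lt_yd|_|eq_yd].
- by apply: ideal_genM; apply: IHd lt_yd _ fy erefl.
- by rewrite mul0r; apply: ideal_gen0.
by rewrite eq_yd subnn pihomog_deg0 al0 // (negbTE yx) mul0r; apply: ideal_gen0.
Qed.

(** * Homogeneity of toric ideals *)

Lemma edge_monomial_dhomog (K : fieldType) (n m : nat) (G : sgraph n m)
    (i : 'I_m) : edge_monomial K G i \is 2.-homog.
Proof.
have <- : (\sum_(v in edge G i) 1 = 2)%N by rewrite sum1_card edge_card.
rewrite /edge_monomial.
apply: (big_ind2 (fun p d => p \is d.-homog)) => [|p d q e|v _].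
- exact: dhomog1.
- exact: dhomogM.
by rewrite dhomogX /= mdeg1.
Qed.

Lemma edge_map_mpolyX (K : fieldType) (n m : nat) (G : sgraph n m)
    (u : 'X_{1..m}) :
  edge_map K G 'X_[u] = \prod_(i < m) edge_monomial K G i ^+ u i.
Proof.
by rewrite /edge_map comp_mpolyX; apply: eq_bigr => i _; rewrite tnth_mktuple.
Qed.

Lemma edge_map_mpolyX_neq0 (K : fieldType) (n m : nat) (G : sgraph n m)
    (u : 'X_{1..m}) : edge_map K G 'X_[u] != 0.
Proof.
rewrite edge_map_mpolyX; apply/prodf_neq0 => i _; apply: expf_neq0.
by apply/prodf_neq0 => v _; rewrite -msupp_eq0 msuppX.
Qed.

Lemma edge_map_mpolyX_dhomog (K : fieldType) (n m : nat) (G : sgraph n m)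
    (u : 'X_{1..m}) : edge_map K G 'X_[u] \is (2 * mdeg u).-homog.
Proof.
rewrite edge_map_mpolyX mdegE big_distrr /=.
apply: (big_ind2 (fun p d => p \is d.-homog)) => [|p d q e|i _].
- exact: dhomog1.
- exact: dhomogM.
exact/dhomogMn/edge_monomial_dhomog.
Qed.

Lemma edge_map_pihomog (K : fieldType) (n m : nat) (G : sgraph n m) (d : nat)
    (p : {mpoly K[m]}) :
  edge_map K G (pihomog mdeg d p) = pihomog mdeg (2 * d) (edge_map K G p).
Proof.
have XE u : edge_map K G (pihomog mdeg d 'X_[u]) =
    pihomog mdeg (2 * d) (edge_map K G 'X_[u]).
  have Xu := edge_map_mpolyX_dhomog K G u; rewrite pihomogX.
  case: eqP => [<-|/eqP ne]; first by rewrite pihomog_dE.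
  by rewrite /edge_map comp_mpoly0 (pihomog_ne0 _ Xu) // eqn_pmul2l.
elim/mpolyind: p => [|c u p _ _ IHp].
  by rewrite pihomog0 /edge_map comp_mpoly0 pihomog0.
have edgeZD q r :
    edge_map K G (c *: q + r) = c *: edge_map K G q + edge_map K G r.
  by rewrite /edge_map comp_mpolyD comp_mpolyZ.
by rewrite linearP /= !edgeZD linearP /= XE IHp.
Qed.

(** If the two monomials had different degrees, the first would be a homogeneous
    component of [p], hence in the kernel of the edge map, which sends monomials
    to monomials. *)
Lemma toric_binomial_homog (K : fieldType) (n m : nat) (G : sgraph n m)
    (p : {mpoly K[m]}) :
  toric_ideal K G p -> is_binomial p -> p \is homog mdeg.
Proof.
move=> Ip [u [v pE]]; have [uv|uv] := eqVneq (mdeg v) (mdeg u).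
  apply/homogP; exists (mdeg u).
  by rewrite pE rpredB ?dhomogX /= ?uv.
have := edge_map_pihomog G (mdeg u) p; rewrite Ip pihomog0 pE pihomogB.
rewrite !pihomogX eqxx (negbTE uv) subr0 => /eqP.
by rewrite (negbTE (edge_map_mpolyX_neq0 _ _ _)).
Qed.

Lemma sub_toric_gens_pihomog (K : fieldType) (n m : nat) (G : sgraph n m)
    (H : subgraph G) (d : nat) (p : {mpoly K[m]}) :
  in_edge_ring H p /\ edge_map K G p = 0 ->
  in_edge_ring H (pihomog mdeg d p) /\ edge_map K G (pihomog mdeg d p) = 0.
Proof.
case=> Hp p0; split; last by rewrite edge_map_pihomog p0 pihomog0.
move=> u; rewrite mcoeff_msupp mcoeff_pihomog.
by case: ifP => _; rewrite ?eqxx // -mcoeff_msupp => /Hp.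
Qed.

Lemma sub_toric_ideal_le (K : fieldType) (n m : nat) (G : sgraph n m)
    (H1 H2 : subgraph G) (p : {mpoly K[m]}) :
  subgraph_le H1 H2 -> sub_toric_ideal K H1 p -> sub_toric_ideal K H2 p.
Proof.
case=> _ /subsetP H12; apply: ideal_gen_mono => q [Hq q0]; split=> //.
by move=> u qu i ui; apply/H12/(Hq u qu).
Qed.

(** * Minimal splittings are reduced *)

Theorem theorem4p7 (K : fieldType) (n m : nat) (G : sgraph n m)
    (G1 G2 : subgraph G) :
  connected_graph G -> minimal_splitting K G1 G2 -> reduced_splitting K G1 G2.
Proof.
move=> _ [G12 [f [g [[[_ f_gen _] f_bin] [[_ g_gen _] g_bin] fg_min]]]].
split=> // H1 H2 H1G1 H2G2 H12; have [splitG _ _] := G12.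
have fg_homog x : x \in f ++ g -> x \is homog mdeg.
  move=> fg_x; apply: (@toric_binomial_homog _ _ _ G).
    by have [_ fg_gen _] := fg_min; apply/fg_gen/mem_ideal_gen.
  by move: fg_x; rewrite mem_cat => /orP[/f_bin|/g_bin].
have I1_add p : sub_toric_ideal K G1 p ->
    ideal_add (sub_toric_ideal K H1) (sub_toric_ideal K G2) p.
  move=> I1p; have /H12[a [b [Ia Ib ->]]] : toric_ideal K G p.
    by apply/splitG; exists p, 0; rewrite addr0; split=> //; apply: ideal_gen0.
  by exists a, b; split=> //; apply: sub_toric_ideal_le Ib.
have I2_add p : sub_toric_ideal K G2 p ->
    ideal_add (sub_toric_ideal K H2) (sub_toric_ideal K G1) p.
  move=> I2p; have /H12/ideal_addC[a [b [Ia Ib ->]]] : toric_ideal K G p.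
    by apply/splitG; exists 0, p; rewrite add0r; split=> //; apply: ideal_gen0.
  by exists a, b; split=> //; apply: sub_toric_ideal_le Ib.
split=> p; split; try exact: sub_toric_ideal_le.
  apply: (min_gens_cat_reduced fg_min fg_homog f_gen g_gen) => //.
    by move=> d q; apply: sub_toric_gens_pihomog.
  by move=> q; apply: sub_toric_ideal_le.
have gf : perm_eq (f ++ g) (g ++ f) by rewrite perm_catC.
apply: (min_gens_cat_reduced (min_gens_perm gf fg_min) _ g_gen f_gen) => //.
- by move=> x; rewrite -(perm_mem gf); apply: fg_homog.
- by move=> d q; apply: sub_toric_gens_pihomog.
by move=> q; apply: sub_toric_ideal_le.
Qed.
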